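(* Let $\mathcal K\subseteq\mathbb R\cup\{\pm\infty\}$ have nonzero Lebesgue measure, let $U\in\mathbb S^n_{\succeq0}$, and let $\boldsymbol g(\tau)=(g_1(\tau),\dots,g_d(\tau))^\top\in\mathcal L^2(\mathcal K;\mathbb R^d)$, $d\in\mathbb N$, satisfy $$\int_{\mathcal K}\boldsymbol g(\tau)\boldsymbol g^\top(\tau)\,d\tau\succ0 .$$ Put $G(\tau)=\boldsymbol g(\tau)\otimes I_n$ and define $\mathsf G\in\mathbb S^d$ by $\mathsf G^{-1}=\int_{\mathcal K}\boldsymbol g(\tau)\boldsymbol g^\top(\tau)\,d\tau$. Then for all $\boldsymbol x(\cdot)\in\mathcal L^2(\mathcal K;\mathbb R^n)$, $$\int_{\mathcal K}\boldsymbol x^\top(\tau)U\boldsymbol x(\tau)\,d\tau\ \ge\ \left(\int_{\mathcal K}\boldsymbol x^\top(\tau)G^\top(\tau)\,d\tau\right)(\mathsf G\otimes U)\left(\int_{\mathcal K}G(\tau)\boldsymbol x(\tau)\,d\tau\right).$$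
   Context: $\mathbb S^n$ is the set of real symmetric $n\times n$ matrices and $\mathbb S^n_{\succeq0}$ the positive semidefinite ones; $X\succ0$ means symmetric positive definite. $\otimes$ is the Kronecker product. $\mathcal L^2(\mathcal K;\mathbb R^n)$ is the space of Lebesgue measurable functions with $\int_{\mathcal K}\|\boldsymbol f(\tau)\|_2^2d\tau<\infty$. *)

(* Defs.v *)
From HB Require Import structures.
From mathcomp Require Import all_boot all_order all_algebra.
From mathcomp Require Import sesquilinear mxtens.
From mathcomp Require Import all_classical all_reals all_analysis.

Set Implicit Arguments.
Unset Strict Implicit.
Unset Printing Implicit Defensive.

Import Order.TTheory GRing.Theory Num.Theory.
Import numFieldNormedType.Exports.

Local Open Scope classical_set_scope.
Local Open Scope ring_scope.

Section SymmetricMatrices.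
Variables (R : realType) (n : nat).

Definition psdmx (A : 'M[R]_n) : Prop :=
  A \is symmetricmx /\ forall v : 'cV[R]_n, 0 <= (v^T *m A *m v) 0 0.

Definition pdmx (A : 'M[R]_n) : Prop :=
  A \is symmetricmx /\
  forall v : 'cV[R]_n, v != 0 -> 0 < (v^T *m A *m v) 0 0.

End SymmetricMatrices.

Section LebesgueOnExtendedReals.
Variable R : realType.

(* The completed measure is used because its measurable sets are all the
   Lebesgue measurable subsets of R; those of [lebesgue_measure] are the Borel
   sets only. *)
Notation leb := (@completed_lebesgue_measure R).
Notation lebT := (caratheodory_type (wlength (@idfun R))^*%mu).

(* The points -oo and +oo form a null set, so measurability, measure and
   integrals over K only see the real points of K. *)
Definition finpart (K : set (\bar R)) : set R := EFin @^-1` K.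

Definition Lmeasurable (K : set (\bar R)) : Prop :=
  measurable (finpart K : set lebT).

Definition Lmeasure (K : set (\bar R)) : \bar R := leb (finpart K).

Definition Lmeasurable_fun (K : set (\bar R)) (f : \bar R -> R) : Prop :=
  measurable_fun (finpart K : set lebT) (fun t : lebT => f (t : R)%:E).

Definition norm2 n (v : 'cV[R]_n) : R := Num.sqrt (\sum_i v i 0 ^+ 2).

Definition L2 (K : set (\bar R)) n (f : \bar R -> 'cV[R]_n) : Prop :=
  (forall i, Lmeasurable_fun K (fun t => f t i 0)) /\
  (\int[leb]_(t in finpart K) (norm2 (f (t : R)%:E) ^+ 2)%:E < +oo)%E.

Definition mxint (K : set (\bar R)) m n (F : \bar R -> 'M[R]_(m, n)) :
    'M[R]_(m, n) :=
  \matrix_(i, j) \int[leb]_(t in finpart K) F (t : R)%:E i j.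

End LebesgueOnExtendedReals.

(* g (x) I_n has size (d * n) x (1 * n), and 1 * n is only provably equal to
   n. *)
Definition kron1 (R : realType) d n (g : 'cV[R]_d) : 'M[R]_(d * n, n) :=
  castmx (erefl _, mul1n n) (g *t (1%:M : 'M[R]_n)).

(* Main.v *)
Require Import Defs.
From mathcomp Require Import all_boot all_order all_algebra.
From mathcomp Require Import sesquilinear mxtens.
From mathcomp Require Import all_classical all_reals all_analysis.
From mathcomp Require Import measurable_realfun.

Import Order.TTheory GRing.Theory Num.Theory.
Import numFieldNormedType.Exports.

Local Open Scope classical_set_scope.
Local Open Scope ring_scope.

(** Write [M] for the integral of [g g^T] (the inverse of [Gs]), [X] for that
    of [x g^T] and [S] for that of [x x^T].  The orthogonal projection of [x]
    onto the span of the components of [g], with vector coefficients, is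
    [X Gs g], and the inequality is Bessel's inequality for it, with the values
    measured by the quadratic form of [U]: the residual [y = x - X Gs g]
    satisfies [0 <= y^T U y] pointwise, and the integral of [y^T U y] equals
    [tr (U (S - X Gs X^T))], the trace against [U] of the Schur complement of
    [M] in the Gram matrix of the stacked function [col_mx g x].  This is
    [gram_schur_le], valid over any measure space; it rests on
    [Rintegral_quad], by which the integral of a quadratic form depends on the
    function only through its Gram matrix.

    The Kronecker products are then only bookkeeping: [(g (x) I_n) x] lists the
    entries of [x g^T], so its integral is [X] read as a vector, and the form
    of [Gs (x) U] at that vector is [tr (U X Gs X^T)] ([kron1_mulmxE] and
    [tens_quad]). *)

Section GramMatrix.
Context {d0 : measure_display} {T : measurableType d0} {R : realType}.
Variable mu : {measure set T -> \bar R}.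
Variable D : set T.
Hypothesis mD : measurable D.

Lemma Rintegral_sum (I : finType) (f : I -> T -> R) :
    (forall i, mu.-integrable D (EFin \o f i)) ->
  \int[mu]_(t in D) (\sum_i f i t) = \sum_i \int[mu]_(t in D) f i t.
Proof.
move=> intf; rewrite /Rintegral.
under eq_integral do rewrite -sumEFin.
rewrite (integral_sum mD intf) -sum_fine// => i _.
exact: integrable_fin_num.
Qed.

Definition sqintegrable (h : T -> R) : Prop :=
  measurable_fun D h /\ mu.-integrable D (fun t => (h t ^+ 2)%:E).

(** Each squared coordinate is dominated by the squared Euclidean norm. *)
Lemma norm2_sqintegrable n (f : T -> 'cV[R]_n) :
    (forall i, measurable_fun D (fun t => f t i 0)) ->
    (\int[mu]_(t in D) (norm2 (f t) ^+ 2)%:E < +oo)%E ->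
  forall i, sqintegrable (fun t => f t i 0).
Proof.
move=> mf fin i; split=> //.
have mf2 j : measurable_fun D (fun t => f t j 0 ^+ 2).
  by apply: measurable_funX; exact: mf.
have norm2E t : norm2 (f t) ^+ 2 = \sum_j f t j 0 ^+ 2.
  by rewrite sqr_sqrtr ?sumr_ge0// => j _; exact: sqr_ge0.
apply/integrableP; split; first exact/measurable_EFinP.
under eq_integral do rewrite abse_EFin ger0_norm ?sqr_ge0//.
apply: le_lt_trans fin; apply: ge0_le_integral => //.
- by move=> t _; rewrite lee_fin sqr_ge0.
- exact/measurable_EFinP.
- apply/measurable_EFinP; under eq_fun do rewrite norm2E.
  exact: measurable_sum.
- move=> t _; rewrite /= lee_fin norm2E.
  by rewrite (bigD1 i)//= lerDl sumr_ge0// => j _; exact: sqr_ge0.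
Qed.

(** By domination: [|h k| <= 2 |h k| <= h^2 + k^2]. *)
Lemma sqintegrable_integrableM (h k : T -> R) :
    sqintegrable h -> sqintegrable k ->
  mu.-integrable D (fun t => (h t * k t)%:E).
Proof.
move=> [mh ih] [mk ik].
apply: (le_integrable mD _ _ (integrableD mD ih ik)).
  by apply/measurable_EFinP; exact: measurable_funM.
move=> t _ /=; rewrite lee_fin normrM [leRHS]ger0_norm ?addr_ge0 ?sqr_ge0//.
rewrite -(real_normK (num_real (h _))) -(real_normK (num_real (k _))).
set a := `|h t|; set b := `|k t|.
have ab2 : a * b *+ 2 <= a ^+ 2 + b ^+ 2.
  by rewrite -subr_ge0 addrAC -sqrrB sqr_ge0.
by apply: le_trans ab2; rewrite mulr2n lerDl mulr_ge0 ?normr_ge0.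
Qed.

Definition gram {m n} (f : T -> 'cV[R]_m) (h : T -> 'cV[R]_n) : 'M[R]_(m, n) :=
  \matrix_(i, j) \int[mu]_(t in D) (f t i 0 * h t j 0).

(** Since [z^T V z = tr (V z z^T)] is linear in [z z^T], the integral commutes
    with [tr (V *m _)]; square integrability makes every entry of [z z^T]
    integrable, as linearity of the integral requires. *)
Lemma Rintegral_quad n (z : T -> 'cV[R]_n) (V : 'M[R]_n) :
    (forall i, sqintegrable (fun t => z t i 0)) ->
  \int[mu]_(t in D) ((z t)^T *m V *m z t) 0 0 = \tr (V *m gram z z).
Proof.
move=> hz; have iz i j := sqintegrable_integrableM _ _ (hz i) (hz j).
have iVz i j : mu.-integrable D (EFin \o fun t => V i j * (z t j 0 * z t i 0)).
  exact: integrableZl (iz j i).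
transitivity (\int[mu]_(t in D) \sum_i \sum_j V i j * (z t j 0 * z t i 0)).
  apply: eq_Rintegral => t _; rewrite -mulmxA mxE; apply: eq_bigr => i _.
  rewrite !mxE mulr_sumr; apply: eq_bigr => j _.
  by rewrite mulrCA [z t i 0 * _]mulrC.
rewrite Rintegral_sum => [|i]; last first.
  rewrite [X in _.-integrable _ X](_ : _ =
    fun t => \sum_j (V i j * (z t j 0 * z t i 0))%:E)%E.
    by apply: integrable_sum => // j _; exact: iVz.
  by apply/funext => t /=; rewrite sumEFin.
apply: eq_bigr => i _; rewrite Rintegral_sum // !mxE.
apply: eq_bigr => j _; rewrite RintegralZl//; last exact: iz.
by rewrite !mxE.
Qed.

Lemma gram_col_mx m n (g : T -> 'cV[R]_m) (x : T -> 'cV[R]_n) :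
  let z t := col_mx (g t) (x t) in
  gram z z = block_mx (gram g g) (gram x g)^T (gram x g) (gram x x).
Proof.
apply/matrixP => i j; case: (split_ordP i) => {}i ->;
  case: (split_ordP j) => {}j ->;
  rewrite ?(block_mxEul, block_mxEur, block_mxEdl, block_mxEdr) !mxE;
  apply: eq_Rintegral => t _; rewrite ?(col_mxEu, col_mxEd) //;
  by rewrite mulrC.
Qed.

(** [U] is nonnegative on the residual [x - gram x g *m A *m g] of the
    projection of [x] onto the span of [g].  In the expansion of the integral,
    the two cross terms and the square of the projection all have absolute
    value [tr (U X A X^T)], where [X = gram x g], because [A] inverts
    [gram g g]; one of them survives, with a minus sign. *)
Lemma gram_schur_le d n (U : 'M[R]_n) (A : 'M[R]_d)
    (g : T -> 'cV[R]_d) (x : T -> 'cV[R]_n) :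
    psdmx U -> A^T = A -> A \in unitmx -> invmx A = gram g g ->
    (forall a, sqintegrable (fun t => g t a 0)) ->
    (forall i, sqintegrable (fun t => x t i 0)) ->
  \tr (U *m (gram x g *m A *m (gram x g)^T)) <=
  \int[mu]_(t in D) ((x t)^T *m U *m x t) 0 0.
Proof.
move=> psdU symA unitA invA hg hx.
(* B maps (g, x) to the residual, so its quadratic form is one of (g, x). *)
pose B : 'M[R]_(n, d + n) := row_mx (- (gram x g *m A)) 1%:M.
pose z t := col_mx (g t) (x t).
have hz i : sqintegrable (fun t => z t i 0).
  by case: (split_ordP i) => {}i ->; rewrite /z;
    [under eq_fun do rewrite col_mxEu | under eq_fun do rewrite col_mxEd].
have : 0 <= \int[mu]_(t in D) ((z t)^T *m (B^T *m U *m B) *m z t) 0 0.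
  apply: Rintegral_ge0 => t _.
  by have := psdU.2 (B *m z t); rewrite trmx_mul !mulmxA.
rewrite !Rintegral_quad// gram_col_mx -invA -!mulmxA mxtrace_mulC -!mulmxA.
rewrite [B *m (_ *m _)]mulmxA mul_row_block tr_row_mx mul_row_col.
rewrite trmx1 mulmx1 !mul1mx mulNmx -mulmxA mulmxV // mulmx1 addNr mul0mx add0r.
by rewrite mulmxDr raddfD /= addrC mulNmx mulmxN raddfN subr_ge0 -!mulmxA.
Qed.

End GramMatrix.

(** When [r] and [c] are the columns of [X] put end to end, multiplying [r] by
    [A (x) U] on the right amounts to [X |-> U^T X A], and the product with [c]
    is then the Frobenius pairing with [X]. *)
Lemma tens_quad {R : realType} {d n} (A : 'M[R]_d) (U : 'M[R]_n)
    (X : 'M[R]_(n, d)) (r : 'rV[R]_(d * n)) (c : 'cV[R]_(d * n)) :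
  (forall a i, r 0 (mxtens_index (a, i)) = X i a) ->
  (forall a i, c (mxtens_index (a, i)) 0 = X i a) ->
  (r *m (A *t U) *m c) 0 0 = \tr (U *m (X *m A^T *m X^T)).
Proof.
move=> rX cX.
have reix (F : 'I_(d * n) -> R) :
    \sum_k F k = \sum_(a < d) \sum_(i < n) F (mxtens_index (a, i)).
  rewrite pair_bigA /= (reindex (@mxtens_index d n)) //=.
    by apply: eq_bigr => -[].
  by exists (@mxtens_unindex d n) => k _;
    [exact: mxtens_indexK | exact: mxtens_unindexK].
have rAU b j : (r *m (A *t U)) 0 (mxtens_index (b, j)) = (U^T *m X *m A) j b.
  rewrite !mxE reix; apply: eq_bigr => a _; rewrite !mxE mulr_suml.
  apply: eq_bigr => i _.
  by rewrite tensmxE rX !mxE mulrA mulrAC [X i a * _]mulrC.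
rewrite -mxtrace_tr !trmx_mul !trmxK mxtrace_mulC !mulmxA.
rewrite mxE reix /mxtrace exchange_big; apply: eq_bigr => j _ /=.
by rewrite mxE; apply: eq_bigr => b _; rewrite rAU cX [X^T _ _]mxE.
Qed.

Lemma kron1_mulmxE {R : realType} {d n} (v : 'cV[R]_d) (y : 'cV[R]_n) a i :
  (kron1 n v *m y) (mxtens_index (a, i)) 0 = y i 0 * v a 0.
Proof.
have kE j : kron1 n v (mxtens_index (a, i)) j = v a 0 * (i == j)%:R.
  rewrite castmxE /= cast_ord_id.
  have -> : cast_ord (esym (mul1n n)) j = mxtens_index (0 : 'I_1, j).
    exact: val_inj.
  by rewrite tensmxE mxE.
rewrite mxE (bigD1 i)//= big1 ?addr0 => [|j ji]; rewrite kE.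
  by rewrite eqxx mulr1 mulrC.
by rewrite eq_sym (negPf ji) mulr0 mul0r.
Qed.

Theorem lemma2p3 (R : realType) (n d : nat) (K : set (\bar R))
    (hK : Lmeasurable K) (hK0 : Lmeasure K <> 0%E)
    (U : 'M[R]_n) (hU : psdmx U)
    (g : \bar R -> 'cV[R]_d) (hg : L2 K g)
    (hgg : pdmx (mxint K (fun t => g t *m (g t)^T)))
    (G : \bar R -> 'M[R]_(d * n, n)) (hG : forall t, G t = kron1 n (g t))
    (Gs : 'M[R]_d) (hGsym : Gs \is symmetricmx) (hGunit : Gs \in unitmx)
    (hGinv : invmx Gs = mxint K (fun t => g t *m (g t)^T)) :
  forall x : \bar R -> 'cV[R]_n, L2 K x ->
    (mxint K (fun t => (x t)^T *m U *m x t)) 0 0 >=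
    (mxint K (fun t => (x t)^T *m (G t)^T) *m (Gs *t U)
       *m mxint K (fun t => G t *m x t)) 0 0.
Proof.
move=> x [mx ix]; have [mg ig] := hg.
have GsT : Gs^T = Gs.
  by move/is_hermitianmxP: hGsym; rewrite expr0 scale1r map_mx_id.
have GxE t a i : (G t *m x t) (mxtens_index (a, i)) 0 = x t i 0 * g t a 0.
  by rewrite hG kron1_mulmxE.
rewrite [leRHS]mxE.
pose X := gram (@completed_lebesgue_measure R) (finpart K)
  (fun t : R => x t%:E) (fun t : R => g t%:E).
rewrite (tens_quad _ _ X); last 2 first.
- move=> a i; rewrite !mxE; apply: eq_Rintegral => t _.
  by rewrite -trmx_mul mxE GxE.
- by move=> a i; rewrite !mxE; apply: eq_Rintegral => t _; rewrite GxE.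
rewrite GsT; apply: gram_schur_le => //.
- rewrite hGinv; apply/matrixP => i j; rewrite !mxE; apply: eq_Rintegral => t _.
  by rewrite !mxE big_ord1 !mxE.
- exact: norm2_sqintegrable.
- exact: norm2_sqintegrable.
Qed.
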